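(* Let $\kappa$ be an uncountable cardinal. Then any two $\kappa$-existentially closed groups are strongly $\kappa$-partially isomorphic.
   Context: For an infinite cardinal $\kappa$, a group $G$ is called $\kappa$-existentially closed if every system of fewer than $\kappa$ many equations and inequations with coefficients from $G$ which has a solution in some overgroup $H\geq G$ already has a solution in $G$. Two groups $A$ and $B$ are strongly $\kappa$-partially isomorphic if there is a non-empty set $I$ of isomorphisms from subgroups of $A$ onto subgroups of $B$ such that: (i) for every $f\in I$ and every $X\subseteq A$ with $|X|<\kappa$ there is $g\in I$ with $X\subseteq \mathrm{dom}(g)$ and $f\subseteq g$; (ii) for every $f\in I$ and every $Y\subseteq B$ with $|Y|<\kappa$ there is $g\in I$ with $Y\subseteq \mathrm{ran}(g)$ and $f\subseteq g$; (iii) $I$ is closed under unions of chains of length less than $\mathrm{cf}(\kappa)$, the cofinality of $\kappa$. *)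

(* Defs.v *)
From HB Require Import structures.
From mathcomp Require Import all_boot.
From mathcomp Require Import boolp classical_sets functions cardinality wochoice.

Set Implicit Arguments.
Unset Strict Implicit.
Unset Printing Implicit Defensive.

Local Open Scope classical_set_scope.
Local Open Scope card_scope.
Local Open Scope group_scope.

Definition card_lt (T U : Type) (X : set T) (Y : set U) : Prop :=
  (X #<= Y) /\ ~ (Y #<= X).

(* A cardinal is an initial ordinal: a well-order [R] on [K] (reflexive form,
   [R x y] meaning x <= y) all of whose proper initial segments have smaller
   cardinality than [K].  The cardinal it denotes is the order type of [R]. *)
Definition is_cardinal (K : Type) (R : rel K) : Prop :=
  well_order R /\
  forall a : K, card_lt [set x | R x a /\ x <> a] [set: K].

Definition cofinal (K : Type) (R : rel K) (C : set K) : Prop :=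
  forall x, exists2 y, C y & R x y.

(* [|J| < cf(R)], where cf(R) is the least cardinality of a cofinal set.  When
   [J] carries a well-order, this says that its order type is an ordinal below
   cf(R), because cf(R) is itself an initial ordinal. *)
Definition card_lt_cofinality (K : Type) (R : rel K) (J : Type) : Prop :=
  forall C : set K, cofinal R C -> card_lt [set: J] C.

(* Group words with coefficients in [G] and variables in [V]; the identity is
   the coefficient [1]. *)
Inductive group_term (G V : Type) : Type :=
| TCoef of G
| TVar of V
| TMul of group_term G V & group_term G V
| TInv of group_term G V.

Inductive group_literal (G V : Type) : Type :=
| Eqn of group_term G V & group_term G V
| Ineqn of group_term G V & group_term G V.

Fixpoint eval_term (G V : Type) (H : groupType) (i : G -> H) (v : V -> H)
    (t : group_term G V) : H :=
  match t with
  | TCoef g => i g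
  | TVar x => v x
  | TMul s t => eval_term i v s * eval_term i v t
  | TInv s => (eval_term i v s)^-1
  end.

Definition literal_holds (G V : Type) (H : groupType) (i : G -> H) (v : V -> H)
    (l : group_literal G V) : Prop :=
  match l with
  | Eqn s t => eval_term i v s = eval_term i v t
  | Ineqn s t => eval_term i v s <> eval_term i v t
  end.

Definition solvable_via (G V : Type) (H : groupType) (i : G -> H)
    (S : set (group_literal G V)) : Prop :=
  exists v : V -> H, forall l, S l -> literal_holds i v l.

(* Overgroups of [G] are given by injective morphisms out of [G]. *)
Definition existentially_closed (K : Type) (G : groupType) : Prop :=
  forall (V : Type) (S : set (group_literal G V)),
    card_lt S [set: K] ->
    (exists (H : groupType) (i : {multiplicative G -> H}),
        injective i /\ solvable_via i S) ->
    solvable_via (@id G) S.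

(* A partial isomorphism is represented by its graph [f], so that extension is
   inclusion and the union of a chain is the union of graphs; [f.`1] is its
   domain and [f.`2] its range. *)
Record is_partial_iso (A B : groupType) (f : set (A * B)) : Prop :=
  IsPartialIso {
    piso_dom : group_closed [in f.`1];
    piso_ran : group_closed [in f.`2];
    piso_fun : forall x y y', f (x, y) -> f (x, y') -> y = y';
    piso_inj : forall x x' y, f (x, y) -> f (x', y) -> x = x';
    piso_mul : forall x y x' y',
      f (x, y) -> f (x', y') -> f (x * x', y * y') }.

(* Chains are increasing families indexed by well-orders.  The empty chain is
   excluded: its union, the empty graph, is not a map between subgroups. *)
Definition closed_under_short_chains (K : Type) (R : rel K) (T : Type)
    (I : set (set T)) : Prop :=
  forall (J : Type) (L : rel J) (c : J -> set T),
    well_order L -> [set: J] !=set0 -> card_lt_cofinality R J ->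
    (forall j, I (c j)) -> (forall j k, L j k -> c j `<=` c k) ->
    I (\bigcup_j c j).

Definition strongly_partially_isomorphic (K : Type) (R : rel K)
    (A B : groupType) : Prop :=
  exists I : set (set (A * B)),
    [/\ I !=set0 /\ (forall f, I f -> is_partial_iso f),
        (forall f (X : set A), I f -> card_lt X [set: K] ->
           exists g, [/\ I g, X `<=` g.`1 & f `<=` g]),
        (forall f (Y : set B), I f -> card_lt Y [set: K] ->
           exists g, [/\ I g, Y `<=` g.`2 & f `<=` g]) &
        closed_under_short_chains R I].

(* Main.v *)
(* The witness is the set of all partial isomorphisms with fewer than kappa
   elements.  To extend such an f : S -> T to a set X of fewer than kappa
   elements of A, let S' be the subgroup generated by S and X.  The system in
   variables x_s (s in S') consisting of the multiplication table of S', the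
   inequations x_s <> x_t for s <> t, and x_s = f(s) for s in S, has fewer than
   kappa members and is solved in an amalgam of A and B over f, hence in B.
   Extension of the range is symmetric.  A union of fewer than cf(kappa) sets of
   size less than kappa has size less than kappa: the sizes are bounded by one
   proper initial segment of kappa, and infinite cardinals are idempotent. *)
Require Import Defs.
From HB Require Import structures.
From mathcomp Require Import all_boot.
From mathcomp Require Import boolp classical_sets functions cardinality wochoice.

Set Implicit Arguments.
Unset Strict Implicit.
Unset Printing Implicit Defensive.

Local Open Scope classical_set_scope.
Local Open Scope card_scope.

(** * Cardinal arithmetic *)

Section CardinalArithmetic.
Implicit Types T U V : Type.

(** A relation may attach several codes to one point, since choice selects one of them. Relations
    also avoid default values in [U], which may be empty. *)
Lemma card_leRP T U (A : set T) (B : set U) :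
  A #<= B <-> exists r : T -> U -> Prop,
    (forall x, A x -> exists2 y, B y & r x y) /\
    (forall x x' y, A x -> A x' -> r x y -> r x' y -> x = x').
Proof.
elim/Ppointed: U => U in B *.
  rewrite emptyE; split=> [/eqP-> | [r [rA _]]]; first by exists (fun _ _ => True).
  by apply/eqP; rewrite -subset0 => x /rA[y]; case: (no y).
split=> [/pcard_leP/injfunPex[f fAB finj] | [r [rAB rinj]]].
  exists (fun x y => f x = y); split=> [x /fAB|x x' y Ax Ax' <- /esym fxx'].
    by exists (f x).
  by apply: finj; rewrite ?inE.
have /choice[f fP] x : exists y, A x -> B y /\ r x y.
  have [/rAB[y By rxy]|nAx] := pselect (A x); first by exists y.
  by exists point.
apply/pcard_leP/injfunPex; exists f => [x /fP[]//|x x'].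
rewrite !inE => Ax Ax' fxx'; have [_ rx] := fP x Ax.
by apply: rinj rx _; rewrite ?fxx' //; have [] := fP x' Ax'.
Qed.

Lemma card_le_fun T U (A : set T) (B : set U) : U -> A #<= B ->
  exists2 f : T -> U, (forall x, A x -> B (f x)) &
    forall x x', A x -> A x' -> f x = f x' -> x = x'.
Proof.
move=> u0 /card_leRP[r [rAB rinj]].
have /choice[f fP] x : exists y, A x -> B y /\ r x y.
  have [/rAB[y By rxy]|nAx] := pselect (A x); first by exists y.
  by exists u0.
exists f => [x /fP[]//|x x' Ax Ax' fxx']; have [_ rx] := fP x Ax.
by apply: rinj rx _; rewrite ?fxx' //; have [] := fP x' Ax'.
Qed.

Lemma fun_card_le T U (A : set T) (B : set U) (f : T -> U) :
  (forall x, A x -> B (f x)) ->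
  (forall x x', A x -> A x' -> f x = f x' -> x = x') -> A #<= B.
Proof.
move=> fAB finj; apply/card_leRP; exists (fun x y => f x = y); split.
  by move=> x /fAB; exists (f x).
by move=> x x' y Ax Ax' <- /esym; apply: finj.
Qed.

(** Zorn's lemma yields a maximal graph [F] of an injection from a part of [A] into [B]. If [F]
    missed both a point of [A] and a point of [B], that pair could be added. *)
Lemma card_le_total T U (A : set T) (B : set U) : A #<= B \/ B #<= A.
Proof.
pose P (F : set (T * U)) := [/\ F `<=` A `*` B,
  forall x y y', F (x, y) -> F (x, y') -> y = y' &
  forall x x' y, F (x, y) -> F (x', y) -> x = x'].
have [C CP Ctot|F [[FAB Ffun Finj] Fmax]] := @Zorn_bigcup _ P.
  have C2 p q : (\bigcup_(X in C) X) p -> (\bigcup_(X in C) X) q ->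
      exists2 X, C X & X p /\ X q.
    move=> [X CX Xp] [Y CY Yq].
    by have [/(_ _ Xp)|/(_ _ Yq)] := Ctot X Y CX CY; [exists Y|exists X].
  split=> [p [X /CP[XAB _ _] /XAB]//|x y y' Wy Wy'|x x' y Wx Wx'].
    by have [X /CP[_ Xfun _] [Xy Xy']] := C2 _ _ Wy Wy'; apply: Xfun Xy Xy'.
  by have [X /CP[_ _ Xinj] [Xx Xx']] := C2 _ _ Wx Wx'; apply: Xinj Xx Xx'.
have [AF|/existsNP[x0 /not_implyP[Ax0 Fx0]]] :=
    pselect (forall x, A x -> exists y, F (x, y)).
  left; apply/card_leRP; exists (fun x y => F (x, y)).
  split=> [x /AF[y Fxy]|x x' y _ _]; last exact: Finj.
  by exists y => //; have [] := FAB _ Fxy.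
have [BF|/existsNP[y0 /not_implyP[By0 Fy0]]] :=
    pselect (forall y, B y -> exists x, F (x, y)).
  right; apply/card_leRP; exists (fun y x => F (x, y)).
  split=> [y /BF[x Fxy]|y y' x _ _]; last exact: Ffun.
  by exists x => //; have [] := FAB _ Fxy.
exfalso; apply: (Fmax (F `|` [set (x0, y0)])).
  split; first by move=> p; left.
  by move=> /(_ (x0, y0)) F00; apply: Fx0; exists y0; apply: F00; right.
split=> [p [/FAB//|->//]|x y y'|x x' y].
  case=> [Fxy|[ex ey]] [Fxy'|[ex' ey']]; last by rewrite ey ey'.
  - exact: Ffun Fxy Fxy'.
  - by case: Fx0; exists y; rewrite -ex'.
  - by case: Fx0; exists y'; rewrite -ex.
case=> [Fxy|[ex ey]] [Fxy'|[ex' ey']]; last by rewrite ex ex'.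
- exact: Finj Fxy Fxy'.
- by case: Fy0; exists x; rewrite -ey'.
- by case: Fy0; exists x'; rewrite -ey.
Qed.

Lemma card_leX T U T' U' (A : set T) (B : set U) (A' : set T') (B' : set U') :
  A #<= A' -> B #<= B' -> A `*` B #<= A' `*` B'.
Proof.
move=> /card_leRP[r [rA rinj]] /card_leRP[s [sB sinj]]; apply/card_leRP.
exists (fun p q => r p.1 q.1 /\ s p.2 q.2); split=> [[x y] /= [/rA[x' Ax' rx] /sB[y' By' sy]]|].
  by exists (x', y').
move=> [x y] [x' y'] [z t] /= [Ax By] [Ax' By'] [rx sy] [rx' sy'].
by congr (_, _); [apply: rinj rx rx'|apply: sinj sy sy'].
Qed.

(** The distinct points [y0] and [y1] serve as tags that embed the union in the square of [Y]. *)
Lemma card_leU_square T U (A B : set T) (Y : set U) (y0 y1 : U) :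
  Y y0 -> Y y1 -> y0 <> y1 -> Y `*` Y #<= Y ->
  A #<= Y -> B #<= Y -> A `|` B #<= Y.
Proof.
move=> Yy0 Yy1 y01 YY AY BY; apply: card_le_trans YY.
have [f fY finj] := card_le_fun y0 AY; have [g gY ginj] := card_le_fun y0 BY.
pose h x := if pselect (A x) then (f x, y0) else (g x, y1).
apply: (fun_card_le (f := h)) => [x|x x']; rewrite /h.
  by case: pselect => [Ax _|nAx [//|Bx]]; split=> //=; [apply: fY|apply: gY].
case: pselect => [Ax _|nAx [//|Bx]]; case: pselect => [Ax' _|nAx' [//|Bx']] [].
- exact: finj.
- by move=> _ /y01.
- by move=> _ /esym/y01.
- exact: ginj.
Qed.

(** Zorn's lemma yields a maximal injection of the square of [Y] into [Y], for infinite subsets [Y]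
    of [A]. If the rest of [A] embeds in [Y], then [A] is no larger than [Y]. Otherwise the rest
    contains a copy [Z] of [Y], and the injection extends to the union of [Y] and [Z], against
    maximality. *)
Lemma card_square T (A : set T) : [set: nat] #<= A -> A `*` A #<= A.
Proof.
move=> natA; have [[a0 Aa0]|nA] := pselect (A !=set0); last first.
  by case/card_leRP: natA => r [/(_ 0%N I)[y Ay]]; case: nA; exists y.
have [f0 f0A f0inj] := card_le_fun a0 natA.
(* The pairing [pickle] of natural numbers, transported along [f0], is the starting injection; it
   keeps [Y] infinite. *)
pose F0 : set (T * T * T) := [set t |
  exists i j, t = (f0 i, f0 j, f0 (pickle (i, j)))].
pose D (F : set (T * T * T)) := [set x | exists z, F (x, x, z)].
(* [good F]: [F] injects [D F `*` D F] into [D F], a subset of [A]. *)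
pose good F := [/\ forall x y z, F (x, y, z) -> [/\ D F x, D F y, D F z & A x],
  forall x y, D F x -> D F y -> exists z, F (x, y, z) &
  forall p p' z, F (p, z) -> F (p', z) -> p = p'].
have DF0 i : D F0 (f0 i) by eexists; exists i, i.
have goodF0 : good F0.
  split=> [_ _ _ [i [j [-> -> ->]]]|_ _ [_ [i [_ [-> _ _]]]] [_ [j [_ [-> _ _]]]]|].
  - by split=> //; apply: f0A.
  - by eexists; exists i, j.
  move=> _ _ z [i [j [-> ->]]] [k [l [->]]] /f0inj-/(_ I I).
  by move=> /(pcan_inj pickleK)[-> ->].
(* Joining [F0] inside the predicate takes care of the empty chain: its union contributes nothing,
   and [F0] alone is good. *)
have [C CP Ctot|F [goodF Fmax]] := @Zorn_bigcup _ [set F | good (F0 `|` F)].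
  pose W := F0 `|` \bigcup_(X in C) X.
  have C2 p q : W p -> W q ->
      exists G, [/\ good G, G `<=` W & G p /\ G q].
    have sub X : C X -> F0 `|` X `<=` W by move=> CX t [|Xt]; [left|right; exists X].
    move=> [Fp|[X CX Xp]] [Fq|[Y CY Yq]].
    - by exists F0; split=> // t; left.
    - by exists (F0 `|` Y); split; [apply: CP|apply: sub|split; [left|right]].
    - by exists (F0 `|` X); split; [apply: CP|apply: sub|split; [right|left]].
    have [/(_ _ Xp) Yp|/(_ _ Yq) Xq] := Ctot X Y CX CY.
      by exists (F0 `|` Y); split; [apply: CP|apply: sub|split; right].
    by exists (F0 `|` X); split; [apply: CP|apply: sub|split; right].
  have subD G : G `<=` W -> D G `<=` D W by move=> GW x [z /GW]; exists z.
  split=> [x y z Wt|x y [z Wx] [t Wy]|p p' z Wp Wp'].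
  - have [G [[Ga _ _] /subD GW [/Ga[Dx Dy Dz Ax] _]]] := C2 _ _ Wt Wt.
    by split=> //; apply: GW.
  - have [G [[_ Gb _] GW [Gx Gy]]] := C2 _ _ Wx Wy.
    have [||u Gu] := Gb x y; [by exists z|by exists t|].
    by exists u; apply: GW.
  - by have [G [[_ _ Gc] GW [Gp Gp']]] := C2 _ _ Wp Wp'; apply: Gc Gp Gp'.
set M := F0 `|` F in goodF; have [Ma Mb Mc] := goodF.
pose Y := D M.
have YA : Y `<=` A by move=> x [z /Ma[]].
have Yf0 i : Y (f0 i) by have [z] := DF0 i; exists z; left.
have f01 : f0 0%N <> f0 1%N by move=> /f0inj-/(_ I I).
have YY : Y `*` Y #<= Y.
  apply/card_leRP; exists (fun p z => M (p, z)); split=> [[x y] [/= Dx Dy]|p p' z _ _].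
    by have [z Mz] := Mb x y Dx Dy; exists z => //; have [] := Ma _ _ _ Mz.
  exact: Mc.
have [AY|/card_leRP[r [rY rinj]]] := card_le_total (A `\` Y) Y.
  have AleY : A #<= Y.
    apply: card_le_trans (card_leU_square (Yf0 0%N) (Yf0 1%N) f01 YY AY (card_lexx Y)).
    by apply: subset_card_le => x Ax; have [] := pselect (Y x); [right|left].
  apply: card_le_trans (card_leX AleY AleY) _.
  by apply: card_le_trans YY _; apply: subset_card_le.
have YAY : Y #<= A `\` Y by apply/card_leRP; exists r.
have [g gAY ginj] := card_le_fun a0 YAY.
pose Z := g @` Y.
have ZY x : Z x -> ~ Y x by move=> [y /gAY[_ ngy] <-].
have ZA : Z `<=` A by move=> _ [y /gAY[Ay _] <-].
have YZ : Y #<= Z by apply: (fun_card_le (f := g)) => // x Yx; exists x.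
have : (Y `|` Z) `*` (Y `|` Z) #<= Z.
  have YZY : Y `|` Z #<= Y.
    exact: card_leU_square (Yf0 0%N) (Yf0 1%N) f01 YY (card_lexx Y) (card_image_le g Y).
  exact: card_le_trans (card_leX YZY YZY) (card_le_trans YY YZ).
case/card_leRP=> s [sZ sinj].
(* The new pairs take values in [Z], which is disjoint from [Y], so they cannot collide with the
   values of [M]. *)
pose N : set (T * T * T) := [set t | [/\ ((Y `|` Z) `*` (Y `|` Z)) t.1,
  ~ (Y `*` Y) t.1, Z t.2 & s t.1 t.2]].
have MY x y z : M (x, y, z) -> [/\ Y x, Y y & Y z] by move=> /Ma[].
have DMN : D (M `|` N) = Y `|` Z.
  apply/seteqP; split=> [x [z [/MY[Yx _ _]|[[//]]]]|x [[z Mx]|Zx]]; first by left.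
    by exists z; left.
  have [|z Zz sz] := sZ (x, x); first by split; right.
  by exists z; right; split=> //; [split; right|move=> [/ZY]].
(* If [N] added nothing to [F], the point [g (f0 0)] of [Z] would lie in [Y]. *)
exfalso; apply: (Fmax (F `|` N)).
  split; first by move=> t; left.
  move=> FN; have [z Nz] : D (M `|` N) (g (f0 0%N)).
    by rewrite DMN; right; exists (f0 0%N).
  have : M (g (f0 0%N), g (f0 0%N), z) by case: Nz => // Nz; right; apply: FN; right.
  by move=> /MY[+ _ _]; apply: ZY; exists (f0 0%N).
rewrite /= setUA -/M; split; rewrite ?DMN.
- move=> x y z [/[dup] /Ma[_ _ _ Ax] /MY[Yx Yy Yz]|[/= [xYZ yYZ] _ Zz _]].
    by split=> //; left.
  by split=> //; [right|case: xYZ => [/YA|/ZA]].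
- move=> x y xYZ yYZ; have [[Yx Yy]|nYxy] := pselect ((Y `*` Y) (x, y)).
    by have [z Mz] := Mb x y Yx Yy; exists z; left.
  by have [|z Zz sz] := sZ (x, y); [split|exists z; right; split].
move=> [x y] [x' y'] z [Mz|[xy nxy Zz sz]] [Mz'|[xy' nxy' Zz' sz']].
- exact: Mc Mz Mz'.
- by have [_ _ /(ZY _ Zz')] := MY _ _ _ Mz.
- by have [_ _ /(ZY _ Zz)] := MY _ _ _ Mz'.
- exact: sinj sz sz'.
Qed.

(** A sequence is coded by its length together with an iterated pairing in [M]. The length is
    recorded because [m0], the code of the empty sequence, may also be the code of a longer one. *)
Lemma card_le_seq T U (A : set T) (M : set U) : [set: nat] #<= M ->
  A #<= M -> [set s | all [in A] s] #<= M.
Proof.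
move=> natM AM; have MM := card_square natM.
have [[m0 Mm0]|nM] := pselect (M !=set0); last first.
  by case/card_leRP: natM => r [/(_ 0%N I)[y My]]; case: nM; exists y.
have [f fM finj] := card_le_fun m0 AM; have [p pM pinj] := card_le_fun m0 MM.
have natMM : [set: nat] `*` M #<= M.
  exact: card_le_trans (card_leX natM (card_lexx M)) MM.
apply: card_le_trans natMM.
pose code := foldr (fun x m => p (f x, m)) m0.
have codeM s : all [in A] s -> M (code s).
  elim: s => //= x s IH /andP[/set_mem Ax As]; apply: pM.
  by split=> /=; [apply: fM|apply: IH].
apply: (fun_card_le (f := fun s => (size s, code s))) => [s /codeM//|].
elim=> [|x s IH] [|x' s'] //= /andP[/set_mem Ax As] /andP[/set_mem Ax' As'].
have MMs y t : A y -> all [in A] t -> (M `*` M) (f y, code t).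
  by move=> Ay At; split; [apply: fM|apply: codeM].
move=> [ss' /(pinj _ _ (MMs _ _ Ax As) (MMs _ _ Ax' As'))[/finj-> // cs]].
by rewrite (IH s') //; rewrite ss' cs.
Qed.

End CardinalArithmetic.

(** * Sets of cardinality less than kappa *)

Section SmallSets.
Variables (K : Type) (R : rel K).
Hypotheses (HR : is_cardinal R) (HK : ~ countable [set: K]).

Local Notation small X := (card_lt X [set: K]).

Let seg (a : K) : set K := [set x | R x a /\ x <> a].

Lemma not_card_le_lt T U (X : set T) (Y : set U) : ~ (Y #<= X) -> card_lt X Y.
Proof. by move=> nYX; split=> //; have [//|] := card_le_total X Y. Qed.

Lemma small_le T U (X : set T) (Y : set U) : X #<= Y -> small Y -> small X.
Proof.
move=> XY [_ nKY]; apply: not_card_le_lt => KX; apply: nKY.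
exact: card_le_trans KX XY.
Qed.

(** Uncountability of kappa enters here: it makes the set of natural numbers small, so that small
    sets always have infinite small bounds. *)
Lemma small_countable T (X : set T) : countable X -> small X.
Proof. by move=> cX; apply: small_le cX _; apply: not_card_le_lt. Qed.

(** The largest of [X], [Y] and the natural numbers serves as [M]. Products and unions then reduce
    to the idempotency of [M]. *)
Lemma small_bound T U (X : set T) (Y : set U) : small X -> small Y ->
  exists (V : Type) (M : set V), [/\ small M, [set: nat] #<= M, X #<= M & Y #<= M].
Proof.
move=> sX sY; have sN := small_countable (card_lexx [set: nat]).
have [XY|YX] := card_le_total X Y.
  have [NY|YN] := card_le_total [set: nat] Y; first by exists U, Y.
  by exists nat, setT; split=> //; apply: card_le_trans XY YN.
have [NX|XN] := card_le_total [set: nat] X; first by exists T, X.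
by exists nat, setT; split=> //; apply: card_le_trans YX XN.
Qed.

Lemma smallX T U (X : set T) (Y : set U) : small X -> small Y -> small (X `*` Y).
Proof.
move=> sX sY; have [V [M [sM NM XM YM]]] := small_bound sX sY.
exact: small_le (card_le_trans (card_leX XM YM) (card_square NM)) sM.
Qed.

Lemma smallU T (X Y : set T) : small X -> small Y -> small (X `|` Y).
Proof.
move=> sX sY; have [V [M [sM NM XM YM]]] := small_bound sX sY.
have /card_leRP[r [rN rinj]] := NM.
have [[m0 Mm0 r0] [m1 Mm1 r1]] := (rN 0%N I, rN 1%N I).
apply: small_le sM; apply: card_leU_square Mm0 Mm1 _ (card_square NM) XM YM.
by move=> m01; rewrite m01 in r0; have := rinj _ _ _ I I r0 r1.
Qed.

Lemma small_image T U (f : T -> U) (X : set T) : small X -> small (f @` X).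
Proof. exact: small_le (card_image_le f X). Qed.

Lemma small_seq T (X : set T) : small X -> small [set s | all [in X] s].
Proof.
move=> sX; have [V [M [sM NM XM _]]] := small_bound sX sX.
exact: small_le (card_le_seq NM XM) sM.
Qed.

Lemma cardinal_min (P : set K) : P !=set0 ->
  exists2 z, P z & forall x, P x -> R z x.
Proof.
move=> [x Px]; have [wo _] := HR.
have [|z [[/asboolP Pz zP] _]] := wo (fun x => `[< P x >]).
  by exists x; apply/asboolP.
by exists z => // y Py; apply: zP; apply/asboolP.
Qed.

(** A well-order is given through unique minima of nonempty sets. The usual order axioms are read
    off from sets of at most three points, antisymmetry from uniqueness. *)
Lemma cardinal_refl x : R x x.
Proof.
by have [|z -> zx] := @cardinal_min [set x]; [exists x|apply: zx].
Qed.

Lemma cardinal_anti x y : R x y -> R y x -> x = y.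
Proof.
move=> Rxy Ryx; have [wo _] := HR.
have [|z [_ zU]] := wo (fun z => `[< z = x \/ z = y >]).
  by exists x; apply/asboolP; left.
by rewrite -(zU x) ?(zU y) //; split; try (by apply/asboolP; auto);
  move=> _ /asboolP[->|->] //; apply: cardinal_refl.
Qed.

Lemma cardinal_leVgt x y : R x y \/ seg x y.
Proof.
have [|z zxy zP] := @cardinal_min [set z | z = x \/ z = y]; first by exists x; left.
have [xy|nxy] := pselect (R x y); [by left|right].
case: zxy zP => -> zP; first by case: nxy; apply: zP; right.
by split; [apply: zP; left|move=> yx; apply: nxy; rewrite yx; apply: cardinal_refl].
Qed.

Lemma seg_trans x y z : seg y x -> seg z y -> seg z x.
Proof.
move=> [Rxy nxy] [Ryz nyz]; have [Rzx|//] := cardinal_leVgt z x.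
have [|t txyz tP] := @cardinal_min [set t | [\/ t = x, t = y | t = z]].
  by exists x; apply: Or31.
case: txyz tP => -> tP.
- by case: nyz; apply: cardinal_anti => //; have <- : x = z;
    [apply: cardinal_anti => //; apply: tP; apply: Or33|].
- by case: nxy; apply: cardinal_anti => //; apply: tP; apply: Or31.
- by case: nyz; apply: cardinal_anti => //; apply: tP; apply: Or32.
Qed.

Lemma seg_wf : well_founded (fun x y => seg y x).
Proof.
move=> x0; apply: contrapT => nAx.
have [|z nAz zP] := @cardinal_min [set x | ~ Acc (fun x y => seg y x) x].
  by exists x0.
apply: nAz; constructor=> y [Ryz nyz]; apply: contrapT => /zP Rzy.
by apply: nyz; apply: cardinal_anti.
Qed.

(* If no segment of [K] received an injection from [X], then a transfinite
   recursion choosing an element of [X] not used before would inject [K] in [X]. *)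
Lemma small_le_seg T (X : set T) : small X -> exists a, X #<= seg a.
Proof.
move=> [_ nKX]; apply: contrapT => /forallNP nXseg.
(* If the values of [f] covered [X], sending each point of [X] to an index where it is taken would
   embed [X] in [seg a]. *)
have pickX a (f : forall b, seg a b -> T) :
    exists x, X x /\ forall b ab, f b ab <> x.
  apply: contrapT => /forallNP nx; apply: (nXseg a); apply/card_leRP.
  exists (fun x b => exists ab, f b ab = x); split=> [x Xx|x x' b _ _ [ab <-] [ab' <-]].
    apply: contrapT => nb; apply: (nx x); split=> // b ab fx.
    by apply: nb; exists b => //; exists ab.
  by rewrite (Prop_irrelevance ab ab').
pose F a f := projT1 (cid (pickX a f)).
pose g := Fix seg_wf (fun=> T) F.
have gE a : g a = F a (fun b _ => g b).
  apply: (Fix_eq seg_wf (fun=> T) F) => b f f' ff'; congr F.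
  by apply: functional_extensionality_dep => c; apply: funext => ?.
have gP a : X (g a) /\ forall b, seg a b -> g b <> g a.
  by rewrite [g a]gE /F; case: cid.
apply: nKX; apply: (fun_card_le (f := g)) => [a _|a b _ _ gab].
  by have [] := gP a.
have [Rab|/(proj2 (gP a))] := cardinal_leVgt a b; last by rewrite gab.
have [//|nab] := pselect (a = b).
by have /(proj2 (gP b)) : seg b a by []; rewrite gab.
Qed.

Lemma small_bigcup T J (c : J -> set T) : card_lt_cofinality R J ->
  (forall j, small (c j)) -> small (\bigcup_j c j).
Proof.
move=> cfJ cs; have sJ : small [set: J].
  by apply: cfJ => x; exists x => //; apply: cardinal_refl.
have /choice[a ca] j : exists a, c j #<= seg a by apply: small_le_seg.
(* As an image of [J], the range of [a] is no larger than [J], whereas every cofinal set is strictly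
   larger. *)
have : ~ cofinal R (range a).
  by move=> /cfJ[_]; apply; apply: card_image_le.
move=> /existsNP[x nx]; have seg_x j : seg (a j) `<=` seg x.
  move=> b bj; apply: seg_trans bj _; have [Rxa|//] := cardinal_leVgt x (a j).
  by case: nx; exists (a j) => //; exists j.
have /choice[r rP] j := (card_leRP _ _).1 (card_le_trans (ca j) (subset_card_le (seg_x j))).
have sJx : small ([set: J] `*` seg x) by apply: smallX => //; apply: HR.2.
apply: small_le sJx; apply/card_leRP.
(* A point of the union is coded by an index [j] and its code within [c j]. It may have several
   codes, one or more for each such [j]. *)
exists (fun t p => c p.1 t /\ r p.1 t p.2); split=> [t [j _ ct]|t t' [j m] _ _ /=].
  by have [b xb rb] := (rP j).1 t ct; exists (j, b).
by move=> [ct rt] [ct' rt']; apply: (rP j).2 rt rt'.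
Qed.

End SmallSets.

(** * Amalgams and partial isomorphisms *)

Local Open Scope group_scope.

(** The inverse is carried as data, so that inversion in the symmetric group merely swaps the
    fields; it is determined by [bij_fun]. *)
Record bijection (X : Type) := Bijection {
  bij_fun : X -> X;
  bij_inv : X -> X;
  bij_funK : cancel bij_fun bij_inv;
  bij_invK : cancel bij_inv bij_fun }.

Lemma bijection_ext X (p q : bijection X) : bij_fun p =1 bij_fun q -> p = q.
Proof.
case: p q => [f f' fK f'K] [g g' gK g'K] /= /funext fg; rewrite -{}fg in gK g'K *.
have fg' : f' = g' by apply: funext => x; rewrite -{1}(g'K x) fK.
by rewrite -fg' in gK g'K *; congr Bijection; apply: Prop_irrelevance.
Qed.

(** * Symmetric groups and permutation representations *)

Section SymmetricGroup.
Variable X : Type.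
Implicit Types p q : bijection X.

Definition bij_one := @Bijection X id id (fun=> erefl) (fun=> erefl).

Definition bij_inverse p := Bijection (bij_invK p) (bij_funK p).

Definition bij_mul p q :=
  Bijection (can_comp (bij_funK p) (bij_funK q)) (can_comp (bij_invK q) (bij_invK p)).

Lemma bij_mulA : associative bij_mul. Proof. by move=> p q r; apply: bijection_ext. Qed.
Lemma bij_mul1 : left_id bij_one bij_mul. Proof. by move=> p; apply: bijection_ext. Qed.
Lemma bij_1mul : right_id bij_one bij_mul. Proof. by move=> p; apply: bijection_ext. Qed.

Lemma bij_mulV : left_inverse bij_one bij_inverse bij_mul.
Proof. by move=> p; apply: bijection_ext => x; apply: bij_funK. Qed.

Lemma bij_Vmul : right_inverse bij_one bij_inverse bij_mul.
Proof. by move=> p; apply: bijection_ext => x; apply: bij_invK. Qed.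

HB.instance Definition _ := gen_eqMixin (bijection X).
HB.instance Definition _ := gen_choiceMixin (bijection X).
HB.instance Definition _ :=
  isGroup.Build (bijection X) bij_mulA bij_mul1 bij_1mul bij_mulV bij_Vmul.

Lemma bij_of_act (G : groupType) (act : G -> X -> X) :
    (forall x, act 1 x = x) -> (forall g h x, act (g * h) x = act g (act h x)) ->
  exists i : {multiplicative G -> bijection X}, forall g, bij_fun (i g) = act g.
Proof.
move=> act1 actM.
have actK g : cancel (act g) (act g^-1) by move=> x; rewrite -actM mulVg act1.
have actVK g : cancel (act g^-1) (act g) by move=> x; rewrite -actM mulgV act1.
pose i g := Bijection (actK g) (actVK g).
have iM : {morph i : g h / g * h} by move=> g h; apply: bijection_ext => x; apply: actM.
pose i' : {multiplicative G -> bijection X} := HB.pack i (isMultiplicative.Build _ _ i iM).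
by exists i'.
Qed.

End SymmetricGroup.

(* The factor [s] in the decomposition [g = p s * t], where [t] is the chosen
   representative of the right coset of [g] modulo [p @` S]. *)
Lemma equivariant_retraction (G H : groupType) (p : {multiplicative H -> G}) (S : set H) :
    S 1 -> (forall s t, S s -> S t -> S (s / t)) ->
    (forall s t, S s -> S t -> p s = p t -> s = t) ->
  exists a : G -> H, (forall g, S (a g)) /\
    (forall s g, S s -> a (p s * g) = s * a g).
Proof.
move=> S1 SV pinj.
have SI s : S s -> S s^-1 by move=> /(SV 1); rewrite div1g; apply.
have SM s t : S s -> S t -> S (s * t) by move=> Ss /SI; rewrite -{2}[t]invgK; apply: SV.
have p1 : p 1 = 1 by apply: (mulgI (p 1)); rewrite -gmulfM !mulg1.
have pV s : p s^-1 = (p s)^-1 by apply: (mulIg (p s)); rewrite -gmulfM !mulVg.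
(* The default [1] is never returned, since [g] lies in its own coset. Elements of one coset define
   the same set, hence get the same representative. *)
pose rep g := xget 1 [set t | exists2 s, S s & g = p s * t].
have repP g : exists2 s, S s & g = p s * rep g.
  by rewrite /rep; case: xgetP => // /(_ g)[]; exists 1; rewrite // p1 mul1g.
have repM s g : S s -> rep (p s * g) = rep g.
  move=> Ss; congr (xget 1 _); apply/seteqP; split=> t [u Su].
    move=> e; exists (s^-1 * u); first by apply: SM => //; apply: SI.
    by rewrite gmulfM pV -mulgA -e mulKg.
  by move=> ->; exists (s * u); [apply: SM|rewrite gmulfM mulgA].
have /choice[a aP] g : exists s, S s /\ g = p s * rep g by have [s] := repP g; exists s.
exists a; split=> [g|s g Ss]; first by have [] := aP g.
have [[Sa ga] [Sb gb]] := (aP g, aP (p s * g)).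
apply: pinj => //; first exact: SM.
by apply: (mulIg (rep g)); rewrite gmulfM -mulgA -ga {2}gb repM.
Qed.

(** * Partial isomorphisms as subgroups of the product *)

Section PartialIso.
Implicit Types A B : groupType.

Lemma group_closedP A (S : set A) :
  group_closed [in S] <-> S 1 /\ forall x y, S x -> S y -> S (x / y).
Proof.
split=> [[/set_mem S1 SV]|[S1 SV]].
  by split=> // x y /mem_set Sx /mem_set Sy; apply/set_mem; apply: SV.
by split=> [|x y /set_mem Sx /set_mem Sy]; apply/mem_set => //; apply: SV.
Qed.

(** The graph is a subgroup of the product on which both projections are injective. This form is
    symmetric in the two groups. *)
Lemma is_partial_isoP A B (f : set (A * B)) : is_partial_iso f <->
  [/\ f 1, forall p q, f p -> f q -> f (p / q),
      forall x y y', f (x, y) -> f (x, y') -> y = y' &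
      forall x x' y, f (x, y) -> f (x', y) -> x = x'].
Proof.
split=> [[/group_closedP[[y1 f1] domV] _ ffun finj fM]|[f1 fV ffun finj]].
  (* The image [y1] of the identity is idempotent, hence trivial. *)
  have f11 : f (1, 1).
    have y11 := fM _ _ _ _ f1 f1; rewrite mulg1 in y11.
    by rewrite (mulgI y1 _ _ (etrans (mulg1 y1) (ffun _ _ _ f1 y11))).
  split=> // -[x y] [x' y'] fxy fxy'.
  have [z fz] := domV 1 x' (ex_intro _ 1 f11) (ex_intro _ y' fxy').
  have zE : z = y'^-1.
    apply: (mulIg y'); rewrite mulVg; apply: ffun f11.
    by have := fM _ _ _ _ fz fxy'; rewrite div1g mulVg.
  by have := fM _ _ _ _ fxy fz; rewrite div1g zE.
split=> // [||x y x' y' fxy fxy'].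
- apply/group_closedP; split=> [|x x' [y fxy] [y' fxy']]; first by exists 1.
  by exists (y / y'); apply: (fV (x, y) (x', y')).
- apply/group_closedP; split=> [|y y' [x fxy] [x' fxy']]; first by exists 1.
  by exists (x / x'); apply: (fV (x, y) (x', y')).
have := fV _ _ fxy (fV _ _ f1 fxy').
by rewrite div1g invgK.
Qed.

(* Both groups act on [A * B]: [a] sends [(x, y)] to [(a * x, s * y)], where
   [s] is the change of the [f]-component from [x] to [a * x], and
   symmetrically for [b].  For [(a, b)] in [f] the two actions coincide. *)
Lemma amalgam A B (f : set (A * B)) : is_partial_iso f ->
  exists (H : groupType) (j : {multiplicative A -> H}) (i : {multiplicative B -> H}),
    [/\ injective j, injective i & forall x y, f (x, y) -> j x = i y].
Proof.
move=> /is_partial_isoP[f1 fV ffun finj].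
have [|a [fa aM]] := @equivariant_retraction A _ fst f f1 fV.
  by move=> [x y] [x' y'] fxy fxy' /= e; move: e fxy => -> /ffun/(_ fxy')->.
have [|b [fb bM]] := @equivariant_retraction B _ snd f f1 fV.
  by move=> [x y] [x' y'] fxy fxy' /= e; move: e fxy => -> /finj/(_ fxy')->.
have [||j jE] := @bij_of_act (A * B) A
  (fun x p => (x * p.1, (a (x * p.1) / a p.1).2 * p.2)).
- by move=> [u v]; rewrite /= !mul1g mulgV mul1g.
- by move=> x x' [u v] /=; rewrite !mulgA mulgVK.
have [||i iE] := @bij_of_act (A * B) B
  (fun y p => ((b (y * p.2) / b p.2).1 * p.1, y * p.2)).
- by move=> [u v]; rewrite /= !mul1g mulgV mul1g.
- by move=> y y' [u v] /=; rewrite !mulgA mulgVK.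
exists (bijection (A * B) : groupType), j, i; split.
(* The action on the base point [(1, 1)] recovers [x] as first coordinate; likewise [y] as second
   coordinate below. *)
- move=> x x' /(congr1 (fun p => bij_fun p 1)); rewrite !jE => -[+ _].
  by rewrite !mulg1.
- move=> y y' /(congr1 (fun p => bij_fun p 1)); rewrite !iE => -[_].
  by rewrite !mulg1.
move=> x y fxy; apply: bijection_ext => -[u v]; rewrite jE iE /=.
(* By equivariance both changes of [f]-component equal [(x, y)], so both actions send [(u, v)] to
   [(x * u, y * v)]. *)
have -> : a (x * u) = (x, y) * a u by apply: (aM (x, y)).
have -> : b (y * v) = (x, y) * b v by apply: (bM (x, y)).
by rewrite !mulgK.
Qed.

End PartialIso.

(** * Extension of small partial isomorphisms *)

Section Extension.
Variables (K : Type) (HK : ~ countable [set: K]).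
Local Notation small X := (card_lt X [set: K]).

(** The generated subgroup consists of products of finite words in [X] and its inverses, and the
    finite words over a small set form a small set. *)
Lemma small_subgroup (G : groupType) (X : set G) : small X ->
  exists S : set G, [/\ X `<=` S, S 1, forall x y, S x -> S y -> S (x / y) & small S].
Proof.
move=> sX; pose Y := X `|` (fun x => x^-1) @` X.
pose prod := foldr (fun x y : G => x * y) 1.
have prod_cat s t : prod (s ++ t) = prod s * prod t.
  by elim: s => [|x s /= ->]; rewrite ?mul1g ?mulgA.
have prodV s : prod (rev (map (fun x => x^-1) s)) = (prod s)^-1.
  elim: s => [|x s IH]; rewrite ?invg1 //= rev_cons -cats1 prod_cat IH /=.
  by rewrite mulg1 invgM.
have YV y : y \in Y -> y^-1 \in Y.
  by rewrite !inE => -[Xy|[x Xx <-]]; [right; exists y|left; rewrite invgK].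
exists (prod @` [set s | all [in Y] s]); split.
- move=> x Xx; exists [:: x]; rewrite /= ?mulg1 // andbT.
  by apply/mem_set; left.
- by exists [::].
- move=> _ _ [s /= Ys <-] [t /= Yt <-]; exists (s ++ rev (map (fun x => x^-1) t)).
    rewrite /= all_cat Ys all_rev all_map; apply: sub_all Yt => y; exact: YV.
  by rewrite prod_cat prodV.
- by apply/small_image/small_seq/smallU => //; apply: small_image.
Qed.

Lemma extend_dom (A B : groupType) (f : set (A * B)) (X : set A) :
    existentially_closed K B -> is_partial_iso f -> small f -> small X ->
  exists g : set (A * B), [/\ is_partial_iso g, small g, X `<=` g.`1 & f `<=` g].
Proof.
move=> ecB pf sf sX.
have [|S [XS S1 SV sS]] := @small_subgroup A (fst @` f `|` X).
  by apply: smallU => //; apply: small_image.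
have fS x y : f (x, y) -> S x by move=> fxy; apply: XS; left; exists (x, y).
(* The elements of [A] themselves serve as variables; only those in [S] occur in the system. *)
pose L : set (group_literal B A) :=
  (fun p => Eqn (TMul (TVar _ p.1) (TVar _ p.2)) (TVar _ (p.1 * p.2))) @` (S `*` S) `|`
  ((fun p => Ineqn (TVar _ p.1) (TVar _ p.2)) @` [set p | (S `*` S) p /\ p.1 <> p.2] `|`
   (fun p => Eqn (TVar _ p.1) (TCoef _ p.2)) @` f).
have sSS : small (S `*` S) by apply: smallX.
have [||v vL] := ecB A L.
- apply: (smallU HK); last apply: (smallU HK); apply: small_image => //.
  by apply: small_le sSS; apply: subset_card_le => p [].
- have [H [j [i [jinj iinj jif]]]] := amalgam pf.
  exists H, i; split=> //; exists j => _ [[p _ <-]|[[p [_ np] <-]|[[x y] fxy <-]]] /=.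
  + by rewrite gmulfM.
  + by move=> /jinj.
  + exact: jif.
have vM x y : S x -> S y -> v (x * y) = v x * v y.
  move=> Sx Sy; apply/esym; apply: (vL (Eqn (TMul (TVar _ x) (TVar _ y)) (TVar _ _))).
  by left; exists (x, y).
have vinj x y : S x -> S y -> v x = v y -> x = y.
  move=> Sx Sy vxy; apply: contrapT => nxy.
  by apply: (vL (Ineqn (TVar _ x) (TVar _ y))) vxy; right; left; exists (x, y).
have vf x y : f (x, y) -> v x = y.
  by move=> fxy; apply: (vL (Eqn (TVar _ x) (TCoef _ y))); right; right; exists (x, y).
have v1 : v 1 = 1 by apply: (mulgI (v 1)); rewrite -vM // !mulg1.
have vV x y : S x -> S y -> v (x / y) = v x / v y.
  move=> Sx Sy; apply: (mulIg (v y)); rewrite -vM ?mulgVK //; exact: SV.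
exists ((fun x => (x, v x)) @` S); split.
- apply/is_partial_isoP; split=> [|_ _ [x Sx <-] [y Sy <-]|x y y'|x x' y].
  + by exists 1 => //; rewrite v1.
  + by exists (x / y); [apply: SV|rewrite vV].
  + by move=> [? _ [-> <-]] [? _ [-> <-]].
  + by move=> [z Sz [<- <-]] [z' Sz' [<- /vinj->]].
- exact: small_image.
- by move=> x Xx; exists (v x); exists x => //; apply: XS; right.
- by move=> [x y] fxy; exists x; rewrite ?(vf _ _ fxy) //; apply: fS fxy.
Qed.

End Extension.

(** * Unions of chains, inverses and the back-and-forth system *)

Lemma partial_iso_bigcup (A B : groupType) (J : Type) (L : rel J) (c : J -> set (A * B)) :
    well_order L -> [set: J] !=set0 -> (forall j, is_partial_iso (c j)) ->
    (forall j k, L j k -> c j `<=` c k) ->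
  is_partial_iso (\bigcup_j c j).
Proof.
move=> wo [j0 _] pc cL.
(* Each condition on the union concerns at most two given points, and these lie in one member of the
   chain: the minimum of two indices makes them comparable. *)
have c2 p q : (\bigcup_j c j) p -> (\bigcup_j c j) q -> exists j, c j p /\ c j q.
  move=> [j _ cp] [k _ cq].
  have [|z [[/asboolP zjk zP] _]] := wo (fun z => `[< z = j \/ z = k >]).
    by exists j; apply/asboolP; left.
  have [Lzj Lzk] : L z j /\ L z k by split; apply: zP; apply/asboolP; auto.
  by case: zjk => ze; rewrite ze in Lzj Lzk;
    [exists k; split=> //; apply: cL cp|exists j; split=> //; apply: cL cq].
have {}pc j := (is_partial_isoP (c j)).1 (pc j).
apply/is_partial_isoP; split=> [|p q cp cq|x y y' cp cq|x x' y cp cq].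
- by exists j0 => //; have [] := pc j0.
- have [j [cjp cjq]] := c2 _ _ cp cq; exists j => //.
  by have [_ cV _ _] := pc j; apply: cV.
- have [j [cjp cjq]] := c2 _ _ cp cq.
  by have [_ _ cfun _] := pc j; apply: cfun cjp cjq.
- have [j [cjp cjq]] := c2 _ _ cp cq.
  by have [_ _ _ cinj] := pc j; apply: cinj cjp cjq.
Qed.

(** Passing to the inverse turns extension of the range into extension of the domain. *)
Lemma partial_iso_flip (A B : groupType) (f : set (A * B)) :
  is_partial_iso f -> is_partial_iso [set p | f (p.2, p.1)].
Proof.
move=> /is_partial_isoP[f1 fV ffun finj]; apply/is_partial_isoP.
by split=> [//|p q /fV|x y y' /finj|x x' y /ffun]; apply.
Qed.

Theorem theorem2p1 (K : Type) (R : rel K) (HR : is_cardinal R)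
    (HK : ~ countable [set: K]%classic) (A B : groupType)
    (HA : existentially_closed K A) (HB : existentially_closed K B) :
  strongly_partially_isomorphic R A B.
Proof.
exists [set f | is_partial_iso f /\ card_lt f [set: K]]; split.
(* The isomorphism between the trivial subgroups is the initial member. *)
- split=> [|f []//]; exists [set 1]; split; last first.
    by apply: small_countable => //; apply: finite_set_countable; apply: finite_set1.
  apply/is_partial_isoP; split=> [//|p q -> ->|x y y' [_ ->] [_ ->]//|x x' y [-> _] [-> _]//].
  by rewrite mulgV.
- move=> f X [pf sf] sX; have [g [pg sg Xg fg]] := extend_dom HK HB pf sf sX.
  by exists g.
- move=> f Y [pf sf] sY.
  have flip_small U V (h : set (U * V)) : card_lt h [set: K] ->
      card_lt [set p | h (p.2, p.1)] [set: K].
    apply: small_le; apply: (fun_card_le (f := fun p => (p.2, p.1))) => //.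
    by move=> [x y] [x' y'] _ _ [-> ->].
  (* With the groups exchanged, the system is solved in [A]. *)
  have [g [pg sg Yg fg]] :=
    extend_dom HK HA (partial_iso_flip pf) (flip_small _ _ _ sf) sY.
  exists [set p | g (p.2, p.1)]; split=> [|y /Yg[x gyx]|[x y] fxy].
  + by split; [apply: partial_iso_flip|apply: flip_small].
  + by exists x.
  + exact: fg.
move=> J L c wo J0 cfJ Ic cL; split.
  by apply: partial_iso_bigcup wo J0 _ cL => j; have [] := Ic j.
by apply: (small_bigcup HR HK cfJ) => j; have [] := Ic j.
Qed.
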